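(* Let $\rho=(n,n-1,\ldots,1)$ be the staircase partition and let $\mu=(k)$ be the one-row partition, where $k$ is a positive integer with $k\le n$. Then $$g_{\rho/\mu}=g_{\rho/\mu^T},$$ where $g_{\lambda/\mu}$ denotes the skew dual stable Grothendieck polynomial and $\mu^T=(1^k)$ is the conjugate partition of $\mu$.
   Context: The skew Young diagram $Y(\lambda/\mu)$, for partitions $\mu\subseteq\lambda$, consists of the cells of the (left-aligned, English-convention) Young diagram of $\lambda$ not in that of $\mu$. The partition $(1^k)$ has $k$ parts equal to $1$. A reverse plane partition of shape $\lambda/\mu$ is a filling of the cells of $Y(\lambda/\mu)$ with positive integers, weakly increasing along each row (left to right) and down each column. For such a filling $P$, let $x^P=\prod_{i\ge1}x_i^{w_i}$, where $w_i$ is the number of columns of $P$ containing the number $i$ (at least once). The skew dual stable Grothendieck polynomial is $g_{\lambda/\mu}=\sum_P x^P$, a formal power series in $x_1,x_2,\ldots$, summed over all reverse plane partitions $P$ of shape $\lambda/\mu$. *)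

(* Defs.v *)
From HB Require Import structures.
From mathcomp Require Import all_boot all_order all_algebra finmap.
From mathcomp Require Import mathcomp_extra boolp classical_sets functions.
From mathcomp Require Import cardinality fsbigop.

Set Implicit Arguments.
Unset Strict Implicit.
Unset Printing Implicit Defensive.

Import Order.TTheory GRing.Theory Num.Theory.

Local Open Scope classical_set_scope.
Local Open Scope fset_scope.
Local Open Scope nat_scope.

(* Partitions are weakly decreasing lists of parts. *)
Definition staircase (n : nat) : seq nat := rev (iota 1 n).

Definition conj_part (mu : seq nat) : seq nat :=
  [seq count (fun p => j < p) mu | j <- iota 0 (head 0 mu)].

Lemma conj_part_row k : conj_part [:: k] = nseq k 1.
Proof.
rewrite /conj_part /=; apply: (@eq_from_nth _ 0).
  by rewrite size_map size_iota size_nseq.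
move=> i; rewrite size_map size_iota => ik.
by rewrite (nth_map 0) ?size_iota // nth_iota //= ik nth_nseq ik.
Qed.

(* The cell (i, j) is in row i (from the top) and column j (from the left),
   both counted from 0. *)
Definition skew_diagram (la mu : seq nat) : seq (nat * nat) :=
  [seq c <- [seq (i, j) | i <- iota 0 (size la), j <- iota 0 (nth 0 la i)]
     | nth 0 mu c.1 <= c.2].

Lemma mem_skew_diagram la mu i j :
  ((i, j) \in skew_diagram la mu) = (nth 0 mu i <= j < nth 0 la i).
Proof.
rewrite mem_filter /=; congr andb.
apply/allpairsPdep/idP => [[a [b [+ + [-> ->]]]]|ij].
  by rewrite !mem_iota !add0n => _.
exists i, j; split=> //; rewrite mem_iota add0n //=.
by rewrite ltnNge; apply: contraTN ij => /(nth_default 0) ->.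
Qed.

Definition cell (la mu : seq nat) := seq_sub (skew_diagram la mu).

Definition posint := {i : nat | 0 < i}.

Definition filling (la mu : seq nat) := {ffun cell la mu -> posint}.

Definition is_rpp la mu (P : filling la mu) : Prop :=
  (forall c d : cell la mu, (val c).1 = (val d).1 ->
     (val c).2 <= (val d).2 -> val (P c) <= val (P d)) /\
  (forall c d : cell la mu, (val c).2 = (val d).2 ->
     (val c).1 <= (val d).1 -> val (P c) <= val (P d)).

Definition columns_with la mu (P : filling la mu) (i : posint) : {fset nat} :=
  [fset (val c).2 | c : cell la mu & P c == i].

(* Monomials in x_1, x_2, ..., as finitely supported exponent vectors. *)
Definition monomial := {fsfun posint -> nat with 0}.

Definition weight la mu (P : filling la mu) : monomial :=
  [fsfun i in [fset P c | c : cell la mu] => #|` columns_with P i| | 0].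

Lemma weightE la mu (P : filling la mu) i :
  weight P i = #|` columns_with P i|.
Proof.
rewrite fsfunE; case: ifPn => // iP; apply/esym/eqP.
rewrite cardfs_eq0; apply/eqP/fsetP => j; rewrite inE.
apply/negP => /imfsetP[c /= ci _]; case/negP: iP.
apply/imfsetP; exists c => //=.
by apply/esym/eqP.
Qed.

(* Formal power series with integer coefficients, given by their coefficient
   functions; posint being infinite, these are series in infinitely many
   variables. *)
Definition power_series := monomial -> int.

Definition monomial_series (m : monomial) : power_series :=
  fun m' => (m == m')%:R%R.

(* The coefficients of the possibly infinite sum of the x^P are computed
   one by one; each of them involves finitely many P (rpp_weight_finite), so
   that the finitely supported sum below is not the default value 0. *)
Definition dual_groth (la mu : seq nat) : power_series :=
  fun m => (\sum_(P \in [set P : filling la mu | is_rpp P])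
              monomial_series (weight P) m)%R.

Lemma rpp_weight_finite la mu (m : monomial) :
  finite_set [set P : filling la mu | is_rpp P /\ weight P = m].
Proof.
pose F := {ffun cell la mu -> finsupp m}.
pose f (h : F) : filling la mu := [ffun c => fsval (h c)].
apply: (@sub_finite_set _ _ (f @` [set: F])); last first.
  exact/finite_image/finite_finset.
move=> P [_ Pm].
have Pin c : P c \in finsupp m.
  rewrite mem_finsupp -Pm weightE cardfs_eq0.
  apply/fset0Pn; exists (val c).2; apply/imfsetP; exists c => //=.
  by rewrite inE.
exists [ffun c => [` Pin c]] => //.
by apply/ffunP => c; rewrite !ffunE.
Qed.

(* Main.v *)
Require Import Defs.
From mathcomp Require Import finmap boolp classical_sets fsbigop.
From mathcomp Require Import all_boot all_order all_algebra.
From mathcomp Require Import zify ring.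

(* Write [g_{rho/mu}] as a sum over chains of order ideals from [mu] to [rho],
   one step per variable, a step [K -> I] having weight x^(number of nonempty
   columns of I\K).  Let H add a horizontal strip to a shape, each row that
   receives a > 0 cells contributing t^a - t^(a-1), and let E add a vertical
   strip with the same weights on columns.  (In the basis of the stable
   Grothendieck polynomials G, H is multiplication by
   1 + (1 - 1/t) \sum_k t^k G_(k).)  Both operators commute with the steps.
   Removing a horizontal or a vertical strip from the staircase is the same
   thing, namely removing corners, with the same weight (t - 1)^(number of
   corners); hence H and E followed by a chain up to rho agree on the empty
   shape, which reads
     \sum_a (t^a - t^(a-1)) (g_{rho/(a)} - g_{rho/(1^a)}) = 0
   as a polynomial in t. *)

Set Implicit Arguments.
Unset Strict Implicit.
Unset Printing Implicit Defensive.

Import GRing.Theory.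

Local Open Scope nat_scope.

(** * Generating functions of a single row *)

Section RowSums.
Local Open Scope ring_scope.
Variables (R : comNzRingType) (t x : R).

Definition strip_wt (d : nat) : R := if d is d'.+1 then t ^+ d - t ^+ d' else 1.

(** Closed form: the sum over [0 <= a <= d] of [strip_wt a * x ^+ (d - a)], the contribution of a
    segment of [d] cells that the strip may fill partially. *)
Fixpoint row_poly (d : nat) : R :=
  if d is d'.+1 then x * row_poly d' + t ^+ d' * (t - 1) else 1.

Arguments strip_wt : simpl nomatch.

Lemma sum_strip_wt p q : (p <= q)%N ->
  \sum_(p <= a < q.+1) strip_wt (a - p) = t ^+ (q - p).
Proof.
elim: q => [|q IH].
  by rewrite leqn0 => /eqP ->; rewrite big_nat1.
rewrite leq_eqVlt => /orP[/eqP <-|pq]; first by rewrite big_nat1 subnn.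
rewrite big_nat_recr ?(ltnW pq) //= IH // subSn // /strip_wt.
by rewrite addrC subrK.
Qed.

(** For [a <= m] the exponent of [x] is constant and the weights telescope to a power of [t]; beyond
    [m] each further cell lowers that exponent by one, which leaves [row_poly]. In the application
    [p] and [l] are the lengths of a row in the inner and outer shapes, [l'] is the next row of the
    outer shape, and [q] bounds the strip. *)
Lemma sum_add_strip p q l l' : (p <= q <= l)%N -> (l' <= l)%N ->
  let m := maxn l' p in
  \sum_(p <= a < q.+1) strip_wt (a - p) * x ^+ (l - maxn l' a)
  = t ^+ (minn m q - p) * x ^+ (l - maxn m q) * row_poly (q - m).
Proof.
move=> /andP[pq ql] l'l m; rewrite {}/m.
elim: q pq ql => [|q IH].
  rewrite leqn0 => /eqP -> _; rewrite big_nat1 /=.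
  by rewrite ?maxn0 minn0 !sub0n mul1r mulr1 ?maxn0.
rewrite leq_eqVlt => /orP[/eqP <-|pq] ql.
  rewrite big_nat1 subnn (minn_idPr _) ?leq_maxr // subnn.
  have -> : (p - maxn l' p = 0)%N by lia.
  by rewrite mul1r /= mulr1 -maxnA maxnn mul1r.
rewrite big_nat_recr ?(ltnW pq) //= IH //; last by lia.
rewrite subSn //=; case: (leqP q.+1 l') => ql'.
  have -> : minn (maxn l' p) q = q by lia.
  have -> : minn (maxn l' p) q.+1 = q.+1 by lia.
  have -> : maxn (maxn l' p) q = l' by lia.
  have -> : maxn (maxn l' p) q.+1 = l' by lia.
  have -> : (q - maxn l' p = 0)%N by lia.
  have -> : (q.+1 - maxn l' p = 0)%N by lia.
  by rewrite subSn //= exprS; ring.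
set m := maxn l' p.
have mq : (m <= q)%N by lia.
rewrite (minn_idPl mq) (minn_idPl (leq_trans mq (leqnSn q))).
rewrite (maxn_idPr mq) (maxn_idPr (leq_trans mq (leqnSn q))).
rewrite (subSn mq) /=.
have -> : (l - q = (l - q.+1).+1)%N by lia.
have -> : (q - p = (m - p) + (q - m))%N by lia.
by rewrite !exprS exprD; ring.
Qed.

(** Counterpart of [sum_add_strip] for removal. The factor [row_poly (q - m)] is the same and the
    exponents of [x] and [t] are exchanged, so that only powers remain to be compared. *)
Lemma sum_rem_strip p m l M : (p <= m <= l)%N -> (p <= M)%N ->
  let q := minn M l in
  \sum_(m <= b < l.+1) strip_wt (l - b) * x ^+ (minn b M - p)
  = x ^+ (minn m q - p) * t ^+ (l - maxn m q) * row_poly (q - m).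
Proof.
move=> /andP[pm ml] pM q.
have [k Ek] : exists k, (m + k = l)%N by exists (l - m)%N; lia.
elim: k m pm ml Ek => [|k IH] m pm ml Ek.
  have -> : m = l by lia.
  rewrite big_nat1 subnn /q.
  have -> : minn l (minn M l) = minn l M by lia.
  have -> : maxn l (minn M l) = l by lia.
  have -> : (minn M l - l = 0)%N by lia.
  by rewrite subnn /= mulr1 mulr1 mul1r.
rewrite big_ltn ?ltnS // IH; try lia.
have -> : (l - m = (l - m.+1).+1)%N by lia.
rewrite /=; have [mM|mM] : (M <= m)%N \/ (m < M)%N by lia.
  have -> : minn m M = M by lia.
  have -> : minn m.+1 q = M by lia.
  have -> : minn m q = M by lia.
  have -> : maxn m.+1 q = m.+1 by lia.
  have -> : maxn m q = m by lia.
  have -> : (q - m.+1 = 0)%N by lia.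
  have -> : (q - m = 0)%N by lia.
  have -> : (l - m = (l - m.+1).+1)%N by lia.
  by rewrite /= exprS; ring.
have mq : (m < q)%N by lia.
have -> : minn m M = m by lia.
have -> : minn m.+1 q = m.+1 by lia.
have -> : minn m q = m by lia.
have -> : maxn m.+1 q = q by lia.
have -> : maxn m q = q by lia.
have -> : (q - m = (q - m.+1).+1)%N by lia.
have -> : (l - m.+1 = (l - q) + (q - m.+1))%N by lia.
have -> : (m.+1 - p = (m - p).+1)%N by lia.
by rewrite /= !exprS exprD; ring.
Qed.

(** All [a < l] carry the same factor [x] and telescope. The term [a = l], present only when
    [q = l], lacks this factor and produces [x + t - 1]. *)
Lemma sum_add_strip_row p q l : (p <= q <= l)%N ->
  \sum_(p <= a < q.+1) strip_wt (a - p) * x ^+ (a < l)%N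
  = if (q < l)%N then x * t ^+ (q - p)
    else if l == p then 1 else t ^+ (l - p).-1 * (x + t - 1).
Proof.
move=> /andP[pq ql]; case: ltnP => lq.
  rewrite -sum_strip_wt // big_distrr /= !big_nat; apply: eq_bigr => a aq.
  have -> : (a < l)%N by lia.
  by rewrite expr1 mulrC.
have -> : q = l by lia.
case: eqP => [->|/eqP lp]; first by rewrite big_nat1 subnn ltnn mulr1.
have [d Ed] : exists d, l = d.+1 by exists l.-1; lia.
rewrite {}Ed in lp ql lq *.
rewrite big_nat_recr /=; last by lia.
rewrite ltnn mulr1 subSn /=; last by lia.
rewrite (eq_big_nat _ _ (F2 := fun a => x * strip_wt (a - p))).
  rewrite -big_distrr /= sum_strip_wt; last by lia.
  by rewrite exprS; ring.
move=> a aq; have -> : (a < d.+1)%N by lia.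
by rewrite expr1 mulrC.
Qed.

Lemma sum_strip_wt_rev m l : (m <= l)%N ->
  \sum_(m <= b < l.+1) strip_wt (l - b) = t ^+ (l - m).
Proof.
move=> ml; rewrite -sum_strip_wt // big_nat_rev /=.
by rewrite !big_nat; apply: eq_bigr => b bl; congr strip_wt; lia.
Qed.

(** As in [sum_add_strip_row], but the term without the factor [x] is now [b = p], present only when
    [m = p]. *)
Lemma sum_rem_strip_row p m l : (p <= m <= l)%N ->
  \sum_(m <= b < l.+1) strip_wt (l - b) * x ^+ (p < b)%N
  = if (p < m)%N then x * t ^+ (l - m)
    else if l == p then 1 else t ^+ (l - p).-1 * (x + t - 1).
Proof.
move=> /andP[pm ml]; case: ltnP => mp.
  rewrite -sum_strip_wt_rev // big_distrr /= !big_nat; apply: eq_bigr => b bm.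
  have -> : (p < b)%N by lia.
  by rewrite expr1 mulrC.
have {pm mp} Em : m = p by lia.
rewrite {}Em in ml *.
case: eqP => [->|/eqP lp]; first by rewrite big_nat1 subnn ltnn mulr1.
rewrite big_ltn ?ltnS // ltnn mulr1.
have [d Ed] : exists d, (l - p = d.+1)%N by exists (l - p).-1; lia.
rewrite (eq_big_nat _ _ (F2 := fun b => x * strip_wt (l - b))).
  rewrite -big_distrr /= sum_strip_wt_rev; last by lia.
  have -> : (l - p.+1 = d)%N by lia.
  by rewrite Ed /= exprS; ring.
move=> b bl; have -> : (p < b)%N by lia.
by rewrite expr1 mulrC.
Qed.

End RowSums.

(** * Order ideals of a square box *)

Lemma sum_nat_ltn n s : \sum_(j < n) (j < s) = minn s n.
Proof.
elim: n => [|n IH]; first by rewrite big_ord0 minn0.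
by rewrite big_ord_recr IH /=; case: (ltnP n s); lia.
Qed.

(** A down-closed predicate is an initial segment, so counting it finds its end. This turns the
    counts defining [rowlen] into comparisons. *)
Lemma downclosed_count n (p : pred nat) (j : nat) :
  (forall i k, i <= k -> p k -> p i) -> j < n ->
  p j = (j < \sum_(k < n) p k).
Proof.
move=> dp; elim: n => // n IH; rewrite ltnS big_ord_recr /=.
case pn: (p n) => jn.
  rewrite (dp j n) // (eq_bigr (fun=> 1)) ?sum1_card ?card_ord; first by lia.
  by move=> i _; rewrite (dp i n) // ltnW.
move: jn; rewrite addn0 leq_eqVlt => /orP[/eqP ->|/IH //].
rewrite pn; apply/esym/negbTE; rewrite -leqNgt.
rewrite -[leqRHS]card_ord -sum1_card; apply: leq_sum => i _.
exact: leq_b1.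
Qed.

Lemma sum_nat_itv n a b : b <= n -> \sum_(j < n) (a <= j < b) = b - a.
Proof.
have H : \sum_(j < n) (a <= j < b) = minn b n - a.
  elim: n => [|n IH]; first by rewrite big_ord0 minn0.
  by rewrite big_ord_recr IH /=; case: (leqP a n); case: (ltnP n b); lia.
by move=> bn; rewrite H (minn_idPl bn).
Qed.

Lemma sum_nat_succ_eq n l k :
  l <= n -> \sum_(i < n) ((i.+1 == l) && (k <= i)) = (k < l).
Proof.
have H : \sum_(i < n) ((i.+1 == l) && (k <= i)) = (k < l <= n).
  elim: n => [|n IH]; first by rewrite big_ord0; lia.
  by rewrite big_ord_recr IH /=; lia.
by move=> ln; rewrite H ln andbT.
Qed.

Section Ideals.
Variable n : nat.
Notation C := ('I_n * 'I_n)%type.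
Implicit Types (I J K : {set C}) (c d : C) (g : nat -> nat).

Definition ideal I :=
  [forall c in I, forall d : C, (d.1 <= c.1) && (d.2 <= c.2) ==> (d \in I)].

Lemma idealP I :
  reflect (forall c d, c \in I -> d.1 <= c.1 -> d.2 <= c.2 -> d \in I)
          (ideal I).
Proof.
apply: (iffP forall_inP) => [H c d /H /forallP /(_ d) /implyP cd d1 d2|H c cI].
  by apply: cd; rewrite d1.
by apply/forallP => d; apply/implyP => /andP[]; apply: H.
Qed.

(** Indices are plain naturals so that row [i.+1] makes sense even below the last row; outside the
    box the value is [false], hence row lengths there are 0. *)
Definition mem_at I (i j : nat) :=
  [exists c in I, (c.1 == i :> nat) && (c.2 == j :> nat)].

Lemma mem_at_ord I c : mem_at I c.1 c.2 = (c \in I).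
Proof.
apply/exists_inP/idP => [[d dI /andP[/eqP d1 /eqP d2]]|cI].
  by rewrite [c]surjective_pairing -(val_inj d1) -(val_inj d2) -surjective_pairing.
by exists c; rewrite ?eqxx.
Qed.

Lemma mem_at_lt I i j : mem_at I i j -> (i < n) && (j < n).
Proof. by case/exists_inP => c _ /andP[/eqP <- /eqP <-]; rewrite !ltn_ord. Qed.

Definition rowlen I (i : nat) := \sum_(j < n) mem_at I i j.

Definition transp I : {set C} := [set c | (c.2, c.1) \in I].

Definition collen I := rowlen (transp I).

Lemma mem_transp I c : (c \in transp I) = ((c.2, c.1) \in I).
Proof. by rewrite inE. Qed.

Lemma transpK : involutive transp.
Proof. by move=> I; apply/setP => -[i j]; rewrite !inE. Qed.

Lemma mem_at_transp I i j : mem_at (transp I) i j = mem_at I j i.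
Proof.
have H K a b : mem_at K a b -> mem_at (transp K) b a.
  case/exists_inP => c cK /andP[ca cb]; apply/exists_inP.
  exists (c.2, c.1); last by rewrite cb.
  by rewrite mem_transp -surjective_pairing.
by apply/idP/idP => [/H|]; rewrite ?transpK // => /H.
Qed.

Lemma ideal_transp I : ideal (transp I) = ideal I.
Proof.
have H J : ideal J -> ideal (transp J).
  move=> /idealP iJ; apply/idealP => c d; rewrite !mem_transp => cJ d1 d2.
  exact: iJ cJ _ _.
by apply/idP/idP => /H //; rewrite transpK.
Qed.

Lemma transpS I J : (transp I \subset transp J) = (I \subset J).
Proof.
have H (A B : {set C}) : A \subset B -> transp A \subset transp B.
  by move=> /subsetP AB; apply/subsetP => c; rewrite !mem_transp => /AB.
by apply/idP/idP => /H //; rewrite !transpK.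
Qed.

Lemma transpD I J : transp (I :\: J) = transp I :\: transp J.
Proof. by apply/setP => c; rewrite !inE. Qed.

Lemma transp_set0 : transp set0 = set0.
Proof. by apply/setP => c; rewrite !inE. Qed.

Lemma ideal_mem_at I i j i' j' : ideal I ->
  i' <= i -> j' <= j -> mem_at I i j -> mem_at I i' j'.
Proof.
move=> /idealP iI ii jj /exists_inP[c cI /andP[/eqP ci /eqP cj]].
have i'n : i' < n by apply: leq_ltn_trans (ltn_ord c.1); rewrite ci.
have j'n : j' < n by apply: leq_ltn_trans (ltn_ord c.2); rewrite cj.
apply/exists_inP; exists (Ordinal i'n, Ordinal j'n); rewrite ?eqxx //.
by apply: iI cI _ _; rewrite /= ?ci ?cj.
Qed.

Lemma rowlen_le I i : rowlen I i <= n.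
Proof.
rewrite -[leqRHS]card_ord -sum1_card; apply: leq_sum => j _; exact: leq_b1.
Qed.

Lemma rowlen_out I i : n <= i -> rowlen I i = 0.
Proof.
move=> ni; apply: big1 => j _.
by case E: (mem_at _ _ _) => //; move/mem_at_lt: E; rewrite ltnNge ni.
Qed.

Lemma ltn_rowlen I i j : ideal I -> j < n -> (j < rowlen I i) = mem_at I i j.
Proof.
move=> iI jn; rewrite (@downclosed_count n (mem_at I i)) // => a b ab.
exact: ideal_mem_at.
Qed.

Lemma mem_rowlen I c : ideal I -> (c \in I) = (c.2 < rowlen I c.1).
Proof. by move=> iI; rewrite ltn_rowlen // mem_at_ord. Qed.

Lemma ltn_rowlen_collen I i j : ideal I -> i < n -> j < n ->
  (j < rowlen I i) = (i < collen I j).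
Proof. by move=> iI *; rewrite !ltn_rowlen ?ideal_transp // mem_at_transp. Qed.

Lemma rowlen_anti I i j : ideal I -> i <= j -> rowlen I j <= rowlen I i.
Proof.
move=> iI ij; apply: leq_sum => k _.
case E: (mem_at I j k) => //.
by rewrite (ideal_mem_at iI ij (leqnn k) E).
Qed.

Lemma subset_rowlen I J : ideal I -> ideal J ->
  reflect (forall i, rowlen I i <= rowlen J i) (I \subset J).
Proof.
move=> iI iJ; apply: (iffP subsetP) => [IJ i|IJ c].
  apply: leq_sum => j _; case E: (mem_at I i j) => //.
  case/exists_inP: E => c cI /andP[/eqP <- /eqP <-].
  by rewrite mem_at_ord IJ.
by rewrite !mem_rowlen // => /leq_trans; apply.
Qed.

Lemma rowlen_inj I J : ideal I -> ideal J ->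
  (forall i, i < n -> rowlen I i = rowlen J i) -> I = J.
Proof.
move=> iI iJ IJ; apply/setP => c.
by rewrite !mem_rowlen // IJ.
Qed.

Definition diag_of g : {set C} := [set c : C | c.2 < g c.1].

Lemma ideal_diag_of g :
  (forall i, i.+1 < n -> g i.+1 <= g i) -> ideal (diag_of g).
Proof.
move=> dg.
have dg' i j : i <= j -> j < n -> g j <= g i.
  elim: j => [|j IH]; first by rewrite leqn0 => /eqP ->.
  rewrite leq_eqVlt => /orP[/eqP -> //|ij] jn.
  by rewrite (leq_trans (dg j jn)) // IH // ltnW.
apply/idealP => c d; rewrite !inE => cg d1 d2.
by rewrite (leq_ltn_trans d2) // (leq_trans cg) // dg'.
Qed.

Lemma rowlen_diag_of g i : i < n -> rowlen (diag_of g) i = minn (g i) n.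
Proof.
move=> ltin; rewrite -sum_nat_ltn; apply: eq_bigr => j _; congr nat_of_bool.
by have := mem_at_ord (diag_of g) (Ordinal ltin, j); rewrite inE.
Qed.

(** * Nonempty rows and columns of a difference of ideals *)

Definition ncols I := #|[set c.2 | c in I]|.

Definition nrows I := #|[set c.1 | c in I]|.

Lemma ncols_transp I : ncols (transp I) = nrows I.
Proof.
apply: eq_card => j; apply/imsetP/imsetP => -[c cI ->].
  by exists (c.2, c.1); rewrite // -mem_transp.
by exists (c.2, c.1); rewrite ?inE /= -?surjective_pairing.
Qed.

Lemma nrows_diff I J : ideal I -> ideal J ->
  nrows (I :\: J) = \sum_(i < n) (rowlen J i < rowlen I i).
Proof.
move=> iI iJ; rewrite /nrows -sum1_card big_mkcond; apply: eq_bigr => i _.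
have -> : (i \in [set c.1 | c in I :\: J]) = (rowlen J i < rowlen I i).
  apply/imsetP/idP => [[c + ->]|ltJI].
    by rewrite inE !mem_rowlen // -leqNgt => /andP[]; apply: leq_ltn_trans.
  have jn : rowlen J i < n by apply: leq_trans ltJI (rowlen_le _ _).
  by exists (i, Ordinal jn); rewrite // inE !mem_rowlen //= ltnn.
by case: ltnP.
Qed.

Lemma ncols_diff I J : ideal I -> ideal J ->
  ncols (I :\: J) = \sum_(j < n) (collen J j < collen I j).
Proof.
move=> iI iJ; rewrite -[I :\: J]transpK ncols_transp transpD.
by rewrite nrows_diff ?ideal_transp.
Qed.

(** Each nonempty column is counted at its lowest cell, which lies in row [i] when the column meets
    row [i] of [I] but not row [i.+1]. *)
Lemma ncols_diff_upper I J : ideal I -> ideal J ->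
  ncols (I :\: J)
  = \sum_(i < n) (rowlen I i - maxn (rowlen I i.+1) (rowlen J i)).
Proof.
move=> iI iJ; rewrite ncols_diff //.
under [RHS]eq_bigr => i _ do rewrite -(sum_nat_itv _ (rowlen_le I i)).
rewrite exchange_big; apply: eq_bigr => j _ /=.
rewrite -(@sum_nat_succ_eq n) ?rowlen_le //; apply: eq_bigr => i _.
congr nat_of_bool.
have h1 := ltn_rowlen_collen iI (ltn_ord i) (ltn_ord j).
have h2 := ltn_rowlen_collen iJ (ltn_ord i) (ltn_ord j).
have l1 : collen I j <= n := rowlen_le _ _.
have h3 : (j < rowlen I i.+1) = (i.+1 < collen I j).
  case: (ltnP i.+1 n) => ilt; first exact: ltn_rowlen_collen.
  by rewrite rowlen_out // ltn0; lia.
lia.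
Qed.

(** Row 0 is bounded by the side of the box, as if a full row stood above it. *)
Definition rowlen_above I (i : nat) := if i is j.+1 then rowlen I j else n.

(** Here each nonempty column is counted at its highest cell, in row [collen J j] for column [j]. *)
Lemma ncols_diff_lower I J : ideal I -> ideal J -> J \subset I ->
  ncols (I :\: J)
  = \sum_(i < n) (minn (rowlen I i) (rowlen_above J i) - rowlen J i).
Proof.
move=> iI iJ JI; rewrite ncols_diff //.
have le i : minn (rowlen I i) (rowlen_above J i) <= n.
  by rewrite geq_min rowlen_le.
under [RHS]eq_bigr => i _ do rewrite -(sum_nat_itv _ (le i)).
rewrite exchange_big; apply: eq_bigr => j _ /=.
have l1 : collen I j <= n := rowlen_le _ _.
rewrite -(@sum_nat_succ_eq n) //.
rewrite (eq_bigr (fun i : 'I_n => (i == collen J j :> nat) && (i < collen I j)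
   : nat)); last first.
  move=> i _; congr nat_of_bool.
  have h1 := ltn_rowlen_collen iI (ltn_ord i) (ltn_ord j).
  have h2 := ltn_rowlen_collen iJ (ltn_ord i) (ltn_ord j).
  have h3 : (j < rowlen_above J i) = (i <= collen J j).
    case: i {h1 h2} => -[|i] ilt /=; first by rewrite ltn_ord.
    by apply: ltn_rowlen_collen => //; apply: ltnW.
  lia.
rewrite sum_nat_succ_eq //.
have H m : \sum_(i < m) ((i == collen J j :> nat) && (i < collen I j))
           = (collen J j < minn (collen I j) m).
  elim: m => [|m IH]; first by rewrite big_ord0; lia.
  by rewrite big_ord_recr IH /=; lia.
by rewrite H (minn_idPl l1).
Qed.

(** Ideals correspond to weakly decreasing row lengths. When the product is expanded over all
    functions, the second hypothesis gives every function that is not weakly decreasing a zero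
    factor, so only ideals survive. *)
Lemma sum_ideal_prod (R : comNzRingType) (T : nat -> nat -> R)
    (F : {set C} -> R) :
  (forall I, ideal I -> F I = \prod_(i < n) T i (rowlen I i))%R ->
  (forall g, (forall i, i < n -> T i (g i) != 0%R) ->
             forall i, i.+1 < n -> g i.+1 <= g i) ->
  (\sum_(I | ideal I) F I = \prod_(i < n) \sum_(0 <= a < n.+1) T i a)%R.
Proof.
move=> FT Tdec.
under [RHS]eq_bigr => i _ do rewrite big_mkord.
rewrite bigA_distr_bigA /=.
pose ext (f : {ffun 'I_n -> 'I_n.+1}) (i : nat) : nat :=
  if insub i is Some i' then f i' else 0.
have extE f (i : 'I_n) : ext f i = f i by rewrite /ext valK.
pose row I : {ffun 'I_n -> 'I_n.+1} :=
  [ffun i : 'I_n => Ordinal (rowlen_le I i : _ < n.+1)].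
rewrite (bigID (fun f : {ffun 'I_n -> 'I_n.+1} => [forall i : 'I_n, forall j : 'I_n,
          (j == i.+1 :> nat) ==> (f j <= f i)])) /=.
rewrite [X in (_ = _ + X)%R]big1 ?GRing.addr0; last first.
  move=> f nf; apply/eqP; apply: contraNT nf => nz.
  apply/forallP => i; apply/forallP => j; apply/implyP => /eqP ji.
  rewrite -!extE ji; apply: Tdec; last by rewrite -ji.
  move=> k kn; apply: contraNneq nz => Tk.
  rewrite (bigD1 (Ordinal kn)) //= -(extE f (Ordinal kn)) /= Tk.
  by rewrite GRing.mul0r.
rewrite (reindex_onto row (fun f => diag_of (ext f))) /=; last first.
  move=> f /forallP fd; apply/ffunP => i; apply/val_inj; rewrite ffunE /=.
  by rewrite rowlen_diag_of // extE; apply/minn_idPl; rewrite -ltnS.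
have rowP I : [forall i : 'I_n, forall j : 'I_n,
    (j == i.+1 :> nat) ==> (row I j <= row I i)]
    && (diag_of (ext (row I)) == I) = ideal I.
  apply/andP/idP => [[/forallP fd /eqP <-]|iI].
    apply: ideal_diag_of => i ilt; have ilt' := ltnW ilt.
    rewrite (extE _ (Ordinal ilt)) (extE _ (Ordinal ilt')).
    have /forallP /(_ (Ordinal ilt)) /implyP := fd (Ordinal ilt').
    by apply.
  split.
    apply/forallP => i; apply/forallP => j; apply/implyP => /eqP ji.
    by rewrite !ffunE /= rowlen_anti // ji.
  apply/eqP/setP => c; rewrite inE mem_rowlen //.
  by rewrite extE ffunE.
apply: eq_big => [I|I iI]; first by rewrite rowP.
by rewrite FT //; apply: eq_bigr => i _; rewrite ffunE.
Qed.

End Ideals.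
Arguments diag_of {n} g.

(** * Adding strips commutes with adding cells *)

Lemma prod_if (R : comNzRingType) (T : finType) (b : pred T) (F : T -> R) :
  (\prod_i (if b i then F i else 0)
   = if [forall i, b i] then \prod_i F i else 0)%R.
Proof.
case: forallP => [bT|/forallP /forallPn [i bi]].
  by apply: eq_bigr => i _; rewrite bT.
by rewrite (bigD1 i) //= (negbTE bi) mul0r.
Qed.

Lemma sum_nat_if (V : nmodType) (F : nat -> V) p q N : q < N ->
  (\sum_(0 <= a < N) (if (p <= a <= q)%N then F a else 0)
   = \sum_(p <= a < q.+1) F a)%R.
Proof.
move=> qN; rewrite [RHS](big_nat_widen _ _ N) // [RHS](big_nat_widenl _ 0) //.
rewrite [RHS]big_mkcond /=; apply: eq_bigr => a _ /=.
by rewrite ltnS andbC.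
Qed.

Section Commutation.
Variables (R : comNzRingType) (t : R) (n : nat).
Implicit Types (I J K : {set 'I_n * 'I_n}).

(** Matrix entry of H from [J] to [I]. The interlacing inequalities say that [I] exceeds [J] by at
    most one cell per column. Transposing both arguments gives the entries of E. *)
Definition strip I J : R :=
  (\prod_(i < n)
     if ((rowlen J i <= rowlen I i) && (rowlen I i.+1 <= rowlen J i))%N
     then strip_wt t (rowlen I i - rowlen J i) else 0)%R.

(** Each inequality between neighbouring rows is moved to the factor of the lower row. For fixed [J]
    every factor then depends on a single row of [I]; in [strip] it depends, for fixed [I], on a
    single row of [J]. *)
Lemma strip_above I J :
  strip I J = (\prod_(i < n)
     if (rowlen J i <= rowlen I i <= rowlen_above J i)%N
     then strip_wt t (rowlen I i - rowlen J i) else 0)%R.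
Proof.
rewrite /strip !prod_if; congr (if _ then _ else _).
apply/forallP/forallP => H i.
  case: i => -[|i] ilt /=.
    by rewrite rowlen_le; case/andP: (H (Ordinal ilt)) => ->.
  have /andP[_ ->] := H (Ordinal (ltnW ilt)).
  by case/andP: (H (Ordinal ilt)) => ->.
have /andP[-> _] /= := H i.
case: (ltnP i.+1 n) => ilt; last by rewrite rowlen_out.
by have /andP[_] := H (Ordinal ilt).
Qed.

Lemma strip_subset I J : ideal I -> ideal J -> strip I J != 0%R -> J \subset I.
Proof.
rewrite /strip prod_if => iI iJ.
case: forallP => [H _|_]; last by rewrite eqxx.
apply/subset_rowlen => // i; case: (ltnP i n) => ilt.
  by case/andP: (H (Ordinal ilt)).
by rewrite rowlen_out.
Qed.

Lemma subset_rowlen_ord I J : ideal I -> ideal J ->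
  (I \subset J) = [forall i : 'I_n, rowlen I i <= rowlen J i].
Proof.
move=> iI iJ; apply/subset_rowlen/forallP => // H i.
case: (ltnP i n) => ilt; first exact: (H (Ordinal ilt)).
by rewrite rowlen_out.
Qed.

(** The bounds combine [strip_above] with inclusion in [I]. They place row [i] of [J] between rows
    [i.+1] and [i] of [K], so row lengths decrease automatically and [sum_ideal_prod] applies. *)
Lemma sum_strip_add (x : R) (e : nat -> nat -> nat) I J : ideal I -> ideal J ->
  (\sum_(K | ideal K && (K \subset I))
      strip K J * x ^+ (\sum_(i < n) e i (rowlen K i))
   = \prod_(i < n)
      \sum_(rowlen J i <= a < (minn (rowlen I i) (rowlen_above J i)).+1)
        strip_wt t (a - rowlen J i) * x ^+ e i a)%R.
Proof.
move=> iI iJ; rewrite big_mkcondr /=.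
pose T i a := (if (rowlen J i <= a <= minn (rowlen I i) (rowlen_above J i))%N
               then strip_wt t (a - rowlen J i) * x ^+ e i a else 0)%R.
rewrite (@sum_ideal_prod n R T); first 1 last.
- move=> K iK; rewrite strip_above subset_rowlen_ord // !prod_if -prodrXr.
  transitivity (if [forall i : 'I_n, rowlen K i <= rowlen I i]%N &&
     [forall i : 'I_n, rowlen J i <= rowlen K i <= rowlen_above J i]%N
     then \prod_(i < n) (strip_wt t (rowlen K i - rowlen J i)
            * x ^+ e i (rowlen K i)) else 0)%R.
    by rewrite big_split; do 2!case: ifP => //=; rewrite ?mul0r.
  rewrite ?prod_if; congr (if _ then _ else _).
  apply/andP/forallP => [[/forallP KI /forallP JK] i|H].
    by rewrite leq_min KI /= JK.
  by split; apply/forallP => i; have := H i; rewrite leq_min; lia.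
- move=> g Tg i ilt; have := Tg _ ilt; have := Tg _ (ltnW ilt); rewrite /T.
  case: ifP => [gi _|]; last by rewrite eqxx.
  case: ifP => [+ _|]; last by rewrite eqxx.
  by rewrite leq_min /=; lia.
apply: eq_bigr => i _; rewrite sum_nat_if //.
by rewrite ltnS geq_min rowlen_le.
Qed.

(** Dually, row [i.+1] of [I] separates rows [i.+1] and [i] of [K]. *)
Lemma sum_strip_rem (x : R) (e : nat -> nat -> nat) I J : ideal I -> ideal J ->
  (\sum_(K | ideal K && (J \subset K))
      strip I K * x ^+ (\sum_(i < n) e i (rowlen K i))
   = \prod_(i < n)
      \sum_(maxn (rowlen I i.+1) (rowlen J i) <= b < (rowlen I i).+1)
        strip_wt t (rowlen I i - b) * x ^+ e i b)%R.
Proof.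
move=> iI iJ; rewrite big_mkcondr /=.
pose T i b := (if (maxn (rowlen I i.+1) (rowlen J i) <= b <= rowlen I i)%N
               then strip_wt t (rowlen I i - b) * x ^+ e i b else 0)%R.
rewrite (@sum_ideal_prod n R T); first 1 last.
- move=> K iK; rewrite /strip subset_rowlen_ord // !prod_if -prodrXr.
  transitivity (if [forall i : 'I_n, rowlen J i <= rowlen K i]%N &&
     [forall i : 'I_n, (rowlen K i <= rowlen I i)
                       && (rowlen I i.+1 <= rowlen K i)]%N
     then \prod_(i < n) (strip_wt t (rowlen I i - rowlen K i)
            * x ^+ e i (rowlen K i)) else 0)%R.
    by rewrite big_split; do 2!case: ifP => //=; rewrite ?mul0r.
  rewrite ?prod_if; congr (if _ then _ else _).
  apply/andP/forallP => [[/forallP JK /forallP KI] i|H].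
    by rewrite geq_max JK /= andbC andbT; apply: KI.
  by split; apply/forallP => i; have := H i; rewrite geq_max; lia.
- move=> g Tg i ilt; have := Tg _ ilt; have := Tg _ (ltnW ilt); rewrite /T.
  case: ifP => [gi _|]; last by rewrite eqxx.
  case: ifP => [+ _|]; last by rewrite eqxx.
  by rewrite !geq_max in gi *; lia.
by apply: eq_bigr => i _; rewrite sum_nat_if // ltnS rowlen_le.
Qed.

(** The maximum and minimum of two numbers add up to their sum, so [m k + q k.+1] is
    [rowlen I k.+1 + rowlen J k]. Summing over [k] shows that the [m i + q i] and the row lengths of
    [I] and [J] have the same total; the same remark applied to [m i] and [q i] concludes. *)
Lemma sum_minmax_rows I J : ideal I -> ideal J -> J \subset I ->
  let m i := maxn (rowlen I i.+1) (rowlen J i) in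
  let q i := minn (rowlen I i) (rowlen_above J i) in
  \sum_(i < n) (minn (m i) (q i) - rowlen J i)
  = \sum_(i < n) (rowlen I i - maxn (m i) (q i)).
Proof.
move=> iI iJ /(subset_rowlen iJ iI) JI m q.
have H k : \sum_(i < k) (m i + q i) + q k
         = \sum_(i < k) (rowlen I i + rowlen J i) + rowlen I k.
  elim: k => [|k IH].
    by rewrite !big_ord0 /q /= (minn_idPl (rowlen_le _ _)).
  rewrite !big_ord_recr /=.
  have : m k + q k.+1 = rowlen I k.+1 + rowlen J k by rewrite /m /q /=; lia.
  move: IH; move: (q k) (q k.+1) (m k) (\sum_(i < k) _) (\sum_(i < k) _).
  by move=> a b c d e; lia.
have {H} := H n; rewrite {2}/q rowlen_out // min0n !addn0 => H.
have Jq (i : 'I_n) : rowlen J i <= q i <= rowlen I i.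
  rewrite /q leq_min JI geq_min leqnn /=.
  case: (i : nat) => [|j]; first by rewrite rowlen_le.
  by rewrite /= (@rowlen_anti _ J j j.+1) .
have mI (i : 'I_n) : rowlen J i <= m i <= rowlen I i.
  by rewrite /m leq_maxr geq_max JI (@rowlen_anti _ I i i.+1).
apply/eqP; rewrite -(eqn_add2r (\sum_(i < n)
  (rowlen J i + maxn (m i) (q i)))) -!big_split /=; apply/eqP.
rewrite (eq_bigr (fun i : 'I_n => m i + q i)); last first.
  by move=> i _; have := Jq i; have := mI i; lia.
rewrite H; apply: eq_bigr => i _.
by have := Jq i; have := mI i; lia.
Qed.

(** H commutes with a step: starting from [J], the left side adds the strip first and the right side
    adds it last. Both sums factor over rows with the same [row_poly] factors, and the powers of [x]
    and [t] agree by [sum_minmax_rows]. *)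
Lemma strip_comm_ncols (x : R) I J : ideal I -> ideal J ->
  (\sum_(K | ideal K && (K \subset I)) strip K J * x ^+ ncols (I :\: K)
   = \sum_(K | ideal K && (J \subset K)) strip I K * x ^+ ncols (K :\: J))%R.
Proof.
move=> iI iJ; case: (boolP (J \subset I)) => JI; last first.
  (* Without the inclusion no [K] fits between [J] and [I], and both sides are 0. *)
  rewrite big1 => [|K /andP[iK KI]]; last first.
    have [->|/(strip_subset iK iJ) JK] := eqVneq (strip K J) 0%R.
      exact: mul0r.
    by rewrite (subset_trans JK KI) in JI.
  rewrite big1 // => K /andP[iK JK].
  have [->|/(strip_subset iI iK) KI] := eqVneq (strip I K) 0%R.
    exact: mul0r.
  by rewrite (subset_trans JK KI) in JI.
transitivity (\sum_(K | ideal K && (K \subset I)) strip K J * x ^+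
   (\sum_(i < n) (rowlen I i - maxn (rowlen I i.+1) (rowlen K i))))%R.
  by apply: eq_bigr => K /andP[iK _]; rewrite ncols_diff_upper.
rewrite (sum_strip_add _ (fun i a => rowlen I i - maxn (rowlen I i.+1) a)) //.
transitivity (\sum_(K | ideal K && (J \subset K)) strip I K * x ^+
   (\sum_(i < n) (minn (rowlen K i) (rowlen_above J i) - rowlen J i)))%R;
  last first.
  by apply: eq_bigr => K /andP[iK JK]; rewrite ncols_diff_lower.
rewrite (sum_strip_rem _ (fun i b => minn b (rowlen_above J i) - rowlen J i)) //.
have JIr := subset_rowlen iJ iI JI.
have Ja i : rowlen J i <= rowlen_above J i.
  by case: i => [|j] /=; rewrite ?rowlen_le // (@rowlen_anti _ J j j.+1).
under eq_bigr => i _.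
  rewrite sum_add_strip ?leq_min ?JIr ?Ja ?geq_min ?leqnn ?(@rowlen_anti _ I i i.+1) //.
  over.
under [RHS]eq_bigr => i _.
  rewrite sum_rem_strip ?Ja ?leq_maxr ?geq_max ?JIr ?(@rowlen_anti _ I i i.+1) //.
  rewrite [minn (rowlen_above _ _) _]minnC.
  over.
rewrite !big_split /= !prodrXr; congr (_ * _)%R.
by rewrite sum_minmax_rows // mulrC.
Qed.

(** This is the commutation of E with a step, read after transposition: columns become rows and the
    vertical strip becomes horizontal. *)
Lemma strip_comm_nrows (x : R) I J : ideal I -> ideal J ->
  (\sum_(K | ideal K && (K \subset I)) strip K J * x ^+ nrows (I :\: K)
   = \sum_(K | ideal K && (J \subset K)) strip I K * x ^+ nrows (K :\: J))%R.
Proof.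
move=> iI iJ; case: (boolP (J \subset I)) => JI; last first.
  rewrite big1 => [|K /andP[iK KI]]; last first.
    have [->|/(strip_subset iK iJ) JK] := eqVneq (strip K J) 0%R.
      exact: mul0r.
    by rewrite (subset_trans JK KI) in JI.
  rewrite big1 // => K /andP[iK JK].
  have [->|/(strip_subset iI iK) KI] := eqVneq (strip I K) 0%R.
    exact: mul0r.
  by rewrite (subset_trans JK KI) in JI.
transitivity (\sum_(K | ideal K && (K \subset I)) strip K J * x ^+
   (\sum_(i < n) (rowlen K i < rowlen I i))%N)%R.
  by apply: eq_bigr => K /andP[iK _]; rewrite nrows_diff.
rewrite (sum_strip_add _ (fun i a => (a < rowlen I i : nat))) //.
transitivity (\sum_(K | ideal K && (J \subset K)) strip I K * x ^+
   (\sum_(i < n) (rowlen J i < rowlen K i))%N)%R; last first.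
  by apply: eq_bigr => K /andP[iK JK]; rewrite nrows_diff.
rewrite (sum_strip_rem _ (fun i b => (rowlen J i < b : nat))) //.
have JIr := subset_rowlen iJ iI JI.
have Ja i : rowlen J i <= rowlen_above J i.
  by case: i => [|j] /=; rewrite ?rowlen_le // (@rowlen_anti _ J j j.+1).
have Id i : rowlen I i.+1 <= rowlen I i by apply: rowlen_anti.
under eq_bigr => i _.
  rewrite sum_add_strip_row ?leq_min ?JIr ?Ja ?geq_min ?leqnn //.
  over.
under [RHS]eq_bigr => i _.
  rewrite sum_rem_strip_row ?leq_maxr ?geq_max ?JIr ?Id //.
  over.
set L := fun i : nat => (if (minn (rowlen I i) (rowlen_above J i) < rowlen I i)%N
  then x * t ^+ (minn (rowlen I i) (rowlen_above J i) - rowlen J i)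
  else if rowlen I i == rowlen J i then 1
  else t ^+ (rowlen I i - rowlen J i).-1 * (x + t - 1))%R.
set M := fun i : nat => (if (rowlen J i < maxn (rowlen I i.+1) (rowlen J i))%N
  then x * t ^+ (rowlen I i - maxn (rowlen I i.+1) (rowlen J i))
  else if rowlen I i == rowlen J i then 1
  else t ^+ (rowlen I i - rowlen J i).-1 * (x + t - 1))%R.
(* Rows overlapping their successor form runs; the two factors of a run only
   agree once the run is complete. *)
have H k : if rowlen_above J k < rowlen I k
  then (\prod_(i < k) L i * x
        = \prod_(i < k) M i * (x + t - 1)
          * t ^+ (rowlen I k - rowlen_above J k).-1)%R
  else (\prod_(i < k) L i = \prod_(i < k) M i)%R.
  elim: k => [|k IH]; first by rewrite ltnNge rowlen_le !big_ord0.
  have JIk := JIr k; have Jak := Ja k; have Ik := Id k.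
  rewrite !big_ord_recr /=.
  have -> : L k = (if (rowlen_above J k < rowlen I k)%N
      then x * t ^+ (rowlen_above J k - rowlen J k)
      else if rowlen I k == rowlen J k then 1
      else t ^+ (rowlen I k - rowlen J k).-1 * (x + t - 1))%R.
    rewrite /L; have [ak|ak] := ltnP (rowlen_above J k) (rowlen I k).
      by rewrite ak.
    by rewrite ltnn.
  have -> : M k = (if (rowlen J k < rowlen I k.+1)%N
      then x * t ^+ (rowlen I k - rowlen I k.+1)
      else if rowlen I k == rowlen J k then 1
      else t ^+ (rowlen I k - rowlen J k).-1 * (x + t - 1))%R.
    rewrite /M; have [ak|ak] := ltnP (rowlen J k) (rowlen I k.+1).
      by rewrite ak.
    by rewrite ltnn.
  move: IH JIk Jak Ik; move: (\prod_(i < k) _)%R (\prod_(i < k) _)%R => Y X.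
  move: (rowlen I k.+1) (rowlen_above J k) (rowlen I k) (rowlen J k).
  move=> l' a l p IH pl pa l'l.
  have texp b c d : b + c = d -> (t ^+ d = t ^+ b * t ^+ c)%R.
    by move=> <-; rewrite exprD.
  (* In order: row [k] is inside a run, ends one, starts one, or stands alone. *)
  case: (ltnP a l) IH => al IH; case: (ltnP p l') => pl'.
  - transitivity (X * x * (x * t ^+ (a - p)))%R; first by ring.
    rewrite IH; transitivity (Y * x * (x + t - 1) * t ^+ (l - p).-1)%R.
      by rewrite (texp (l - a).-1 (a - p) (l - p).-1); [ring|lia].
    by rewrite (texp (l - l') (l' - p).-1 (l - p).-1); [ring|lia].
  - have -> : (l == p) = false by lia.
    rewrite mulrA IH (texp (l - a).-1 (a - p) (l - p).-1); [ring|lia].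
  - have -> : (l == p) = false by lia.
    by rewrite IH (texp (l - l') (l' - p).-1 (l - p).-1); [ring|lia].
  - by rewrite IH.
(* Row [n] of [I] is empty, so no run is left open. *)
by have := H n; rewrite rowlen_out.
Qed.

End Commutation.

(** * Chains of order ideals ending at the staircase *)

Lemma transp_subset n (I J : {set 'I_n * 'I_n}) :
  (transp I \subset J) = (I \subset transp J).
Proof. by rewrite -[in RHS]transpS transpK. Qed.

Section Chains.
Variable n : nat.
Implicit Types (I J K L : {set 'I_n * 'I_n}) (m : nat -> nat).

(** Coefficient of the monomial with exponents [m 1], ..., [m k] in the sum over chains of [k] steps
    from [J] up to [I]; the last step is split off first. A step with exponent 0 leaves the ideal
    unchanged. *)
Fixpoint chains m k I J : nat :=
  if k is k'.+1 then
    \sum_(K | ideal K && (K \subset I))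
      (ncols (I :\: K) == m k) * chains m k' K J
  else I == J.

(** With [S] and the steps read as matrices indexed by ideals, an [S] that commutes with every
    one-step matrix commutes with their products. *)
Lemma chains_intertwine (R : comNzRingType) m k
    (S : {set 'I_n * 'I_n} -> {set 'I_n * 'I_n} -> R) :
  (forall c I J, ideal I -> ideal J ->
     \sum_(K | ideal K && (K \subset I)) S K J * (ncols (I :\: K) == c)%:R
     = \sum_(K | ideal K && (J \subset K))
         S I K * (ncols (K :\: J) == c)%:R)%R ->
  forall I J, ideal I -> ideal J ->
  (\sum_(K | ideal K) (chains m k I K)%:R * S K J
   = \sum_(K | ideal K) S I K * (chains m k K J)%:R)%R.
Proof.
move=> Scomm; elim: k => [|k IH] I J iI iJ.
  rewrite (bigD1 I) //= eqxx mul1r big1 => [|K /andP[_ /negbTE KI]]; last first.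
    by rewrite eq_sym KI mul0r.
  rewrite [RHS](bigD1 J) //= eqxx mulr1 big1 => [//|K /andP[_ /negbTE ->]].
  by rewrite mulr0.
transitivity (\sum_(L | ideal L && (L \subset I)) (ncols (I :\: L) == m k.+1)%:R
    * \sum_(K | ideal K) (chains m k L K)%:R * S K J)%R.
  under [RHS]eq_bigr => L _ do rewrite big_distrr /=.
  rewrite exchange_big /=; apply: eq_bigr => K iK.
  rewrite natr_sum big_distrl /=; apply: eq_bigr => L _.
  by rewrite natrM mulrA.
transitivity (\sum_(K | ideal K)
    (\sum_(L | ideal L && (L \subset I)) S L K
       * (ncols (I :\: L) == m k.+1)%:R) * (chains m k K J)%:R)%R.
  under [RHS]eq_bigr => K _ do rewrite big_distrl /=.
  rewrite [RHS]exchange_big /=; apply: eq_bigr => L /andP[iL _].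
  rewrite IH // big_distrr; apply: eq_bigr => K _ /=.
  by rewrite mulrA [(_ * S _ _)%R]mulrC.
transitivity (\sum_(K | ideal K)
    (\sum_(L | ideal L && (K \subset L)) S I L
       * (ncols (L :\: K) == m k.+1)%:R) * (chains m k K J)%:R)%R.
  by apply: eq_bigr => K iK; rewrite Scomm.
under eq_bigr => K _ do rewrite big_distrl /= big_mkcondr.
rewrite exchange_big /=; apply: eq_bigr => L iL.
rewrite natr_sum big_distrr /= [RHS]big_mkcondr; apply: eq_bigr => K iK.
by case: ifP => // _; rewrite natrM mulrA.
Qed.

(** * Commutation of strips with a step of fixed weight *)

Section Kernels.
Variables (R : comNzRingType) (t : R).

Lemma strip_polyC I J : strip t%:P%R I J = (strip t I J)%:P%R.
Proof.
rewrite /strip rmorph_prod; apply: eq_bigr => i _ /=.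
case: ifP => _; last by rewrite polyC0.
case: (rowlen I i - rowlen J i) => [|d]; first by rewrite /= polyC1.
by rewrite /strip_wt rmorphB !rmorphXn.
Qed.

(** Coefficient of ['X^c] in [strip_comm_ncols] over [{poly R}], with [t] a constant. *)
Lemma strip_comm_link c I J : ideal I -> ideal J ->
  (\sum_(K | ideal K && (K \subset I)) strip t K J * (ncols (I :\: K) == c)%:R
   = \sum_(K | ideal K && (J \subset K))
       strip t I K * (ncols (K :\: J) == c)%:R)%R.
Proof.
move=> iI iJ.
have := congr1 (coefp c) (strip_comm_ncols t%:P%R 'X%R iI iJ).
rewrite /= !coef_sum => E.
etransitivity; [|etransitivity; [exact: E|]]; apply: eq_bigr => K _;
  by rewrite strip_polyC coefCM coefXn eq_sym.
Qed.

(** The same extraction from [strip_comm_nrows] at the transposed ideals. *)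
Lemma strip_transp_comm_link c I J : ideal I -> ideal J ->
  (\sum_(K | ideal K && (K \subset I))
      strip t (transp K) (transp J) * (ncols (I :\: K) == c)%:R
   = \sum_(K | ideal K && (J \subset K))
       strip t (transp I) (transp K) * (ncols (K :\: J) == c)%:R)%R.
Proof.
rewrite -(ideal_transp I) -(ideal_transp J) => iI iJ.
have := congr1 (coefp c) (strip_comm_nrows t%:P%R 'X%R iI iJ).
rewrite /= !coef_sum => E.
etransitivity; [|etransitivity; [exact: E|]];
  rewrite (reindex_inj (inv_inj (@transpK n))) /=; apply: eq_big => K;
  rewrite ?ideal_transp ?transpS ?transp_subset // => _;
  by rewrite ?transpK strip_polyC coefCM coefXn eq_sym -ncols_transp transpD !transpK.
Qed.

(** * Strips at the two ends of a chain: the staircase and the empty shape *)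

Definition stair : {set 'I_n * 'I_n} := diag_of (fun i => n - i).

Lemma ideal_stair : ideal stair.
Proof. by apply: ideal_diag_of => i _; lia. Qed.

Lemma rowlen_stair i : rowlen stair i = n - i.
Proof.
case: (ltnP i n) => ilt; last by rewrite rowlen_out //; lia.
by rewrite rowlen_diag_of //; lia.
Qed.

Lemma mem_stair c : (c \in stair) = (c.1 + c.2 < n).
Proof. by rewrite inE ltn_subRL. Qed.

Lemma transp_stair : transp stair = stair.
Proof. by apply/setP => c; rewrite mem_transp !mem_stair addnC. Qed.

Lemma card_diff_rowlen I J : ideal I -> ideal J ->
  #|I :\: J| = \sum_(i < n) (rowlen I i - rowlen J i).
Proof.
move=> iI iJ; rewrite -sum1_card big_mkcond.
under [RHS]eq_bigr => i _ do rewrite -(sum_nat_itv _ (rowlen_le I i)).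
rewrite pair_big; apply: eq_bigr => c _ /=.
by rewrite inE !mem_rowlen // -leqNgt; case: ifP.
Qed.

(* A horizontal strip at the outer rim of the staircase is a set of corners,
   and so is a vertical strip. *)
Lemma strip_stair K : ideal K ->
  strip t stair K =
  (if [forall c : 'I_n * 'I_n, ((c \in K) ==> (c.1 + c.2 < n)%N)
                   && ((c.1 + c.2 < n.-1)%N ==> (c \in K))]
   then (t - 1) ^+ #|stair :\: K| else 0)%R.
Proof.
move=> iK; rewrite /strip prod_if.
have -> : [forall i : 'I_n, (rowlen K i <= rowlen stair i)
                            && (rowlen stair i.+1 <= rowlen K i)]
  = [forall c : 'I_n * 'I_n, ((c \in K) ==> (c.1 + c.2 < n)%N)
                   && ((c.1 + c.2 < n.-1)%N ==> (c \in K))].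
  apply/forallP/forallP => [H [i j]|H i].
    have := H i; rewrite !rowlen_stair mem_rowlen //=.
    by have := ltn_ord i; case: ltnP; case: ltnP; lia.
  rewrite !rowlen_stair; apply/andP; split.
    rewrite leqNgt; apply/negP => lt.
    have nin : n - i < n by apply: leq_trans lt (rowlen_le _ _).
    have := H (i, Ordinal nin); rewrite mem_rowlen //= lt /=.
    by lia.
  rewrite leqNgt; apply/negP => lt.
  have nin : rowlen K i < n by lia.
  have := H (i, Ordinal nin); rewrite mem_rowlen //= ltnn /= implybF.
  by lia.
case: forallP => // H; rewrite card_diff_rowlen ?ideal_stair // -prodrXr.
(* Each row loses at most one cell, so its factor is 1 or [t - 1]. *)
apply: eq_bigr => i _; have : rowlen stair i - rowlen K i <= 1.
  rewrite rowlen_stair leqNgt; apply/negP => lt.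
  have nin : rowlen K i < n by lia.
  have := H (i, Ordinal nin); rewrite mem_rowlen //= ltnn /= implybF.
  by lia.
case: (_ - _) => [|[|//]] _; first by rewrite expr0.
by rewrite /= expr1 expr0.
Qed.

(** The condition and the exponent in [strip_stair] are symmetric in the two coordinates. *)
Lemma strip_stair_transp K : ideal K ->
  strip t stair (transp K) = strip t stair K.
Proof.
move=> iK; rewrite !strip_stair ?ideal_transp //.
have -> : stair :\: transp K = transp (stair :\: K).
  by rewrite transpD transp_stair.
have -> : #|transp (stair :\: K)| = #|stair :\: K|.
  rewrite -!sum1_card (reindex (fun c : 'I_n * 'I_n => (c.2, c.1))) /=.
    by apply: eq_bigl => -[i j]; rewrite mem_transp.
  by exists (fun c : 'I_n * 'I_n => (c.2, c.1)) => -[].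
congr (if _ then _ else _).
by apply/forallP/forallP => H [i j]; have := H (j, i);
  rewrite mem_transp /= addnC.
Qed.

Definition shape (la : seq nat) : {set 'I_n * 'I_n} := diag_of (nth 0 la).

Lemma rowlen_set0 i : rowlen (set0 : {set 'I_n * 'I_n}) i = 0.
Proof.
apply: big1 => j _; case E: (mem_at _ _ _) => //.
by case/exists_inP: E => c; rewrite inE.
Qed.

Lemma ideal_set0 : ideal (set0 : {set 'I_n * 'I_n}).
Proof. by apply/idealP => c d; rewrite inE. Qed.

Lemma ideal_shape_row a : ideal (shape [:: a]).
Proof. by apply: ideal_diag_of => -[|i] _ /=; rewrite ?nth_nil. Qed.

Lemma shape_col a : shape (nseq a 1) = transp (shape [:: a]).
Proof.
apply/setP => -[i j]; rewrite !inE /= nth_nseq.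
by case: j => -[|j] /= _; case: (i < a) => /=; rewrite ?nth_nil ?ltnS ?ltn0.
Qed.

(** A horizontal strip on the empty shape is a single row. The range stops at [n] because the box
    cuts longer rows down to the same shape, and each row must be listed once. *)
Lemma strip_set0 K : 0 < n -> ideal K ->
  strip t K set0
  = (\sum_(0 <= a < n.+1) (K == shape [:: a])%:R * strip_wt t a)%R.
Proof.
move=> n0 iK.
have Krow a : a <= n -> K = shape [:: a] -> rowlen K 0 = a.
  by move=> an ->; rewrite rowlen_diag_of //= (minn_idPl an).
have [K1|K1] := eqVneq (rowlen K 1) 0.
  have KE : K = shape [:: rowlen K 0].
    apply: rowlen_inj (ideal_shape_row _) _ => // -[|i] ilt.
      by rewrite rowlen_diag_of //= (minn_idPl (rowlen_le _ _)).
    rewrite rowlen_diag_of //= ?nth_nil min0n.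
    by apply/eqP; rewrite -leqn0 -K1; apply: rowlen_anti.
  rewrite (bigD1_seq (rowlen K 0)) ?iota_uniq ?mem_index_iota ?ltnS ?rowlen_le //=.
  rewrite big1_seq ?addr0; last first.
    move=> a /andP[aK]; rewrite mem_index_iota /= ltnS => an.
    case: eqP => [/(Krow _ an) Ka|_]; last by rewrite mul0r.
    by rewrite Ka eqxx in aK.
  rewrite -KE eqxx mul1r /strip (bigD1 (Ordinal n0)) //= !rowlen_set0 K1.
  rewrite subn0 big1 ?mulr1 // => i i0.
  rewrite rowlen_set0.
  have Ki j : 0 < j -> rowlen K j = 0.
    by move=> j0; apply/eqP; rewrite -leqn0 -K1; apply: rowlen_anti.
  by rewrite !Ki //; rewrite lt0n; apply: contraNneq i0 => i0; apply/eqP/val_inj.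
rewrite big1_seq.
  by rewrite /strip (bigD1 (Ordinal n0)) //= !rowlen_set0 leqn0 (negbTE K1) mul0r.
move=> a /andP[_ _]; case: eqP => [KE|]; last by rewrite mul0r.
have n1 : 1 < n.
  by rewrite ltnNge; apply: contraNN K1 => n1; rewrite rowlen_out.
by move: K1; rewrite KE rowlen_diag_of //= min0n eqxx.
Qed.

(** On the empty shape H produces the rows. It is moved through the chain up to the staircase,
    exchanged there for E, and moved back down, where E produces the columns. *)
Lemma sum_chains_rows m k : 0 < n ->
  (\sum_(0 <= a < n.+1)
     strip_wt t a * (chains m k stair (shape [:: a]))%:R
   = \sum_(0 <= a < n.+1)
     strip_wt t a * (chains m k stair (shape (nseq a 1)))%:R)%R.
Proof.
move=> n0.
have rowsum (F : {set 'I_n * 'I_n} -> R) :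
  (\sum_(K | ideal K) F K * strip t K set0
   = \sum_(0 <= a < n.+1) strip_wt t a * F (shape [:: a]))%R.
  under eq_bigr => K iK do rewrite strip_set0 // big_distrr /=.
  rewrite exchange_big /=; apply: eq_bigr => a _.
  rewrite (bigD1 (shape [:: a])) ?ideal_shape_row //= eqxx mul1r mulrC.
  by rewrite big1 ?addr0 // => K /andP[_ /negbTE ->]; rewrite mul0r mulr0.
rewrite -(rowsum (fun K => (chains m k stair K)%:R%R)).
rewrite (chains_intertwine m k strip_comm_link ideal_stair ideal_set0).
(* The exchange of H for E at the staircase. *)
under eq_bigr => K iK do rewrite -strip_stair_transp // -{1}transp_stair.
rewrite -(chains_intertwine m k strip_transp_comm_link ideal_stair ideal_set0).
rewrite transp_set0 (reindex_inj (inv_inj (@transpK n))) /=.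
under eq_bigl => K do rewrite ideal_transp.
under eq_bigr => K _ do rewrite transpK.
rewrite (rowsum (fun K => (chains m k stair (transp K))%:R%R)).
by apply: eq_bigr => a _; rewrite shape_col.
Qed.

End Kernels.

(** Take [t] to be the indeterminate of [{poly int}] in [sum_chains_rows]. The differences [d a]
    become coefficients of a polynomial killed by the nonzero factor ['X - 1], so they vanish. *)
Lemma chains_row_col m b k : 0 < k <= n ->
  chains m b stair (shape [:: k]) = chains m b stair (shape (nseq k 1)).
Proof.
move=> /andP[k0 kn].
pose d a : int := ((chains m b stair (shape [:: a]))%:R
                   - (chains m b stair (shape (nseq a 1)))%:R)%R.
suff /eqP : d k = 0%R by rewrite subr_eq0 Num.Theory.eqr_nat => /eqP.
(* The weight of [a = 0] is 1 and has no factor ['X - 1], so this term is disposed of separately;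
   hence the index shift below. *)
have d0 : d 0 = 0%R.
  rewrite /d; have -> : shape [:: 0] = shape [::].
    by apply/setP => -[i j]; rewrite !inE /=; case: (i : nat) => [|[]].
  by rewrite subrr.
have : (('X - 1) * \poly_(a < n) d a.+1 = 0 :> {poly int})%R.
  have := sum_chains_rows ('X : {poly int})%R m b (leq_trans k0 kn).
  move=> /eqP; rewrite -subr_eq0 -sumrB => /eqP <-.
  transitivity (\sum_(0 <= a < n.+1) strip_wt 'X a * (d a)%:P)%R; last first.
    by apply: eq_bigr => a _; rewrite -mulrBr rmorphB !rmorph_nat.
  rewrite big_nat_recl // d0 polyC0 mulr0 add0r poly_def big_distrr big_mkord.
  by apply: eq_bigr => i _; rewrite -mul_polyC /= exprS; ring.
move=> /eqP; rewrite mulf_eq0 => /orP[|/eqP /polyP /(_ k.-1)].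
  by rewrite -polyC1 polyXsubC_eq0.
by rewrite coef_poly coef0 prednK // kn.
Qed.

End Chains.

(** * Fillings as chains of level sets *)

Section Levels.
Variables n b : nat.
Notation C := ('I_n * 'I_n)%type.
(* The value [0] marks the cells of the inner shape and the value [b.+1] those
   outside the outer shape. *)
Notation levels := {ffun 'I_n * 'I_n -> 'I_b.+2}.
Implicit Types (I J K : {set C}) (Q : levels) (m : nat -> nat).

Definition lev Q (j : nat) : {set C} := [set c | Q c <= j].

Definition good_level m Q (j : nat) :=
  ideal (lev Q j) && (ncols (lev Q j :\: lev Q j.-1) == m j).

(** Encodes a chain of [k] steps from [J]. Cells not reached after [k] steps carry [ord_max], so
    that the chain determines [Q]. *)
Definition good m J (k : nat) Q :=
  [&& lev Q 0 == J, all (good_level m Q) (iota 1 k)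
    & [forall c, (Q c <= k) || (Q c == ord_max)]].

Lemma levS Q i j : i <= j -> lev Q i \subset lev Q j.
Proof.
by move=> ij; apply/subsetP => c; rewrite !inE => /leq_trans; apply.
Qed.

Lemma good_lev_ideal m J k Q j :
  ideal J -> good m J k Q -> j <= k -> ideal (lev Q j).
Proof.
move=> iJ /and3P[/eqP Q0 /allP H _]; case: j => [|j] jk; first by rewrite Q0.
have /H /andP[] // : j.+1 \in iota 1 k by rewrite mem_iota; lia.
Qed.

Definition trunc_above (k : nat) Q : levels :=
  [ffun c => if Q c <= k then Q c else ord_max].

Definition fill_level (k : nat) I Q : levels :=
  [ffun c => if (c \in I) && (k < Q c) then inord k.+1 else Q c].

Lemma lev_trunc_above k Q j : j <= k -> k <= b ->
  lev (trunc_above k Q) j = lev Q j.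
Proof.
move=> jk kb; apply/setP => c; rewrite !inE ffunE.
by case: ifP => // Qk; apply/idP/idP => /=; lia.
Qed.

Lemma good_trunc_above m J k Q : k <= b ->
  good m J k (trunc_above k Q) =
  (lev Q 0 == J) && all (good_level m Q) (iota 1 k).
Proof.
move=> kb; rewrite /good lev_trunc_above //.
have -> : [forall c, (trunc_above k Q c <= k) ||
                     (trunc_above k Q c == ord_max)].
  by apply/forallP => c; rewrite ffunE; case: ifP => [->|] //; rewrite eqxx orbT.
rewrite andbT; congr (_ && _); apply: eq_in_all => j.
rewrite mem_iota => jk; rewrite /good_level !lev_trunc_above //; lia.
Qed.

(** Forgetting the last step, by [trunc_above], and restoring it from its upper end [I], by
    [fill_level], are mutually inverse. The bound [k < b] keeps the new value [k.+1] apart from the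
    marker [ord_max]. *)
Lemma card_good_step m J I k : ideal I -> ideal J -> k < b ->
  #|[set Q | good m J k.+1 Q & lev Q k.+1 == I]|
  = #|[set Q | [&& good m J k Q, lev Q k \subset I
                 & ncols (I :\: lev Q k) == m k.+1]]|.
Proof.
move=> iI iJ kb; rewrite -!sum1_card.
rewrite [RHS](reindex_onto (trunc_above k) (fill_level k I)) /=.
  apply: eq_bigl => Q; rewrite !inE lev_trunc_above ?(ltnW kb) //.
  rewrite good_trunc_above ?(ltnW kb) // /good.
  have -> : iota 1 k.+1 = iota 1 k ++ [:: k.+1] by rewrite -[k.+1]addn1 iotaD /= add1n addn1.
  rewrite all_cat /= /good_level /=.
  apply/idP/idP.
    move=> /andP[/and3P[-> /andP[-> /andP[/andP[_ nc] _]] /forallP rg] /eqP QI].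
    subst I; rewrite nc levS //=; apply/eqP/ffunP => c; rewrite !ffunE.
    have := rg c; rewrite inE; case: (leqP (Q c) k) => Qk /=.
      by rewrite ltnNge Qk andbF.
    rewrite ltnS (ltnW kb) andbT => /orP[Qk1|/eqP ->]; last first.
      by rewrite /= ltnS leqNgt kb.
    rewrite Qk1; apply/val_inj; rewrite /= inordK; lia.
  move=> /andP[/and3P[/andP[-> ->] sub nc] /eqP/ffunP QE].
  have QI : lev Q k.+1 = I.
    apply/setP => c; rewrite inE; have := QE c; rewrite !ffunE.
    case: (leqP (Q c) k) => Qk.
      move=> _; rewrite (leq_trans Qk) //; apply/esym.
      by apply: (subsetP sub); rewrite inE.
    rewrite /= ltnS (ltnW kb) andbT; case: (c \in I) => <- /=.
      by rewrite inordK //; lia.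
    by rewrite ltnS leqNgt kb.
  rewrite QI iI nc eqxx /= andbT; apply/forallP => c.
  have := QE c; rewrite !ffunE -QI inE; case: (leqP (Q c) k) => Qk.
    by rewrite (leq_trans Qk).
  by case: (leqP (Q c) k.+1) => //= _ <-.
move=> Q; rewrite inE => /and3P[/and3P[_ _ /forallP rg] _ _].
apply/ffunP => c; rewrite !ffunE; have := rg c.
case: (leqP (Q c) k) => Qk /=; first by rewrite andbF Qk.
move=> /eqP ->; rewrite andbT.
case: (c \in I) => /=; last by case: ifP.
rewrite inordK ?ltnn //; lia.
Qed.

Lemma card_good m J I k : ideal I -> ideal J -> k <= b ->
  #|[set Q | good m J k Q & lev Q k == I]| = chains m k I J.
Proof.
move=> + iJ; elim: k I => [|k IH] I iI kb.
  rewrite /=; case: eqP => [->|IJ]; last first.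
    apply: eq_card0 => Q; rewrite !inE; apply/negP.
    by move=> /andP[/and3P[/eqP QJ _ _] /eqP QI]; rewrite -QI -QJ in IJ.
  (* With no step, the only level function is 0 on [J] and the marker elsewhere. *)
  transitivity #|[set ([ffun c => if c \in J then ord0 else ord_max] : levels)]|;
    last by rewrite cards1.
  apply: eq_card => Q; rewrite !inE; apply/idP/eqP.
    move=> /andP[/and3P[_ _ /forallP rg] /eqP <-].
    apply/ffunP => c; rewrite ffunE inE; have := rg c.
    case: leqP => [|_ /eqP //]; rewrite leqn0 => /eqP Q0 _.
    exact: val_inj.
  move=> ->; have E : lev [ffun c => if c \in J then ord0 else ord_max] 0 = J.
    by apply/setP => c; rewrite inE ffunE; case: ifP.
  rewrite /good E eqxx /= andbT; apply/forallP => c; rewrite ffunE.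
  by case: ifP; rewrite ?eqxx ?orbT.
rewrite card_good_step //= -sum1_card.
rewrite (partition_big (fun Q => lev Q k)
  (fun K => ideal K && (K \subset I))) /=; last first.
  move=> Q; rewrite inE => /and3P[gQ -> _].
  by rewrite andbT (good_lev_ideal iJ gQ).
apply: eq_bigr => K /andP[iK KI]; rewrite -IH ?(ltnW kb) //.
case: eqP => [nc|nc]; last first.
  rewrite mul0n big1 // => Q /andP[]; rewrite inE => /and3P[_ _ /eqP nc'].
  by move=> /eqP QK; rewrite -QK in nc.
rewrite mul1n -sum1_card; apply: eq_bigl => Q; rewrite !inE.
case: (eqVneq (lev Q k) K) => [->|]; last by rewrite !andbF.
by rewrite KI nc eqxx !andbT.
Qed.

End Levels.

Definition exponent (m : monomial) (i : nat) : nat :=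
  if insub i is Some p then m p else 0.

(** * Reverse plane partitions as level functions *)

Section Fillings.
Variables (n b : nat) (la mu : seq nat) (m : monomial).
Notation C := ('I_n.+1 * 'I_n.+1)%type.
Notation levels := {ffun 'I_n.+1 * 'I_n.+1 -> 'I_b.+2}.
Notation box := (shape n.+1).
Hypothesis la_size : size la <= n.+1.
Hypothesis la_le : forall i, nth 0 la i <= n.+1.
Hypothesis la_ideal : ideal (box la).
Hypothesis mu_ideal : ideal (box mu).
Hypothesis mu_la : forall i, nth 0 mu i <= nth 0 la i.
Hypothesis m_le : forall i : posint, b < val i -> m i = 0.
Implicit Types (P : filling la mu) (Q : levels) (d : cell la mu) (c : C).

Definition cell_box d : C := (inord (val d).1, inord (val d).2).

Lemma cell_bounds d : nth 0 mu (val d).1 <= (val d).2 < nth 0 la (val d).1.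
Proof.
by rewrite -mem_skew_diagram -surjective_pairing; apply: (valP d).
Qed.

Lemma cell_box1 d : (cell_box d).1 = (val d).1 :> nat.
Proof.
have /andP[_ lt] := cell_bounds d; rewrite inordK // (leq_trans _ la_size) //.
by rewrite ltnNge; apply: contraTN lt => /(nth_default 0) ->.
Qed.

Lemma cell_box2 d : (cell_box d).2 = (val d).2 :> nat.
Proof.
have /andP[_ lt] := cell_bounds d; rewrite inordK // (leq_trans lt) //.
Qed.

Lemma mem_box s c : (c \in box s) = (c.2 < nth 0 s c.1).
Proof. by rewrite inE. Qed.

Lemma cell_box_la d : cell_box d \in box la.
Proof.
by rewrite mem_box cell_box1 cell_box2; case/andP: (cell_bounds d).
Qed.

Lemma cell_box_mu d : cell_box d \notin box mu.
Proof.
by rewrite mem_box cell_box1 cell_box2 -leqNgt; case/andP: (cell_bounds d).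
Qed.

Lemma cell_box_surj c : c \in box la -> c \notin box mu ->
  exists d, cell_box d = c.
Proof.
rewrite !mem_box -leqNgt => cla cmu.
have sc : (c.1 : nat, c.2 : nat) \in skew_diagram la mu.
  by rewrite mem_skew_diagram cmu.
exists (SeqSub sc); rewrite /cell_box /= !inord_val.
by case: c {cla cmu sc}.
Qed.

Lemma cell_box_inj : injective cell_box.
Proof.
move=> d e de; apply/val_inj; rewrite [val d]surjective_pairing.
by rewrite -cell_box1 -cell_box2 de cell_box1 cell_box2 -surjective_pairing.
Qed.

(** These level functions correspond to arbitrary fillings with entries at most [b]; monotonicity is
    imposed later. *)
Definition fits Q :=
  [&& lev Q 0 == box mu, lev Q b == box la
    & [forall c, (Q c <= b) || (Q c == ord_max)]].

Definition posint1 : posint := exist _ 1 isT.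

(** When [Q] fits, the default [posint1] is never reached: cells outside [mu] have positive
    level. *)
Definition filling_of Q : filling la mu :=
  [ffun d => insubd posint1 (Q (cell_box d) : nat)].

Lemma filling_ofE Q d : fits Q -> val (filling_of Q d) = Q (cell_box d) :> nat.
Proof.
move=> /and3P[/eqP Q0 _ _]; rewrite ffunE val_insubd.
have := cell_box_mu d; rewrite -Q0 inE -ltnNge => ->.
by [].
Qed.

Lemma fits_le Q d : fits Q -> Q (cell_box d) <= b.
Proof.
by move=> /and3P[_ /eqP Qb _]; have := cell_box_la d; rewrite -Qb inE.
Qed.

Lemma filling_of_inj : {in fits &, injective filling_of}.
Proof.
move=> Q Q' fQ fQ' QQ'; apply/ffunP => c.
have /and3P[/eqP Q0 /eqP Qb /forallP rQ] := fQ.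
have /and3P[/eqP Q0' /eqP Qb' /forallP rQ'] := fQ'.
have [cmu|cmu] := boolP (c \in box mu).
  apply/val_inj; move: (cmu) (cmu); rewrite -{1}Q0 -Q0' !inE /= !leqn0.
  by move=> /eqP -> /eqP ->.
have [cla|cla] := boolP (c \in box la).
  have [d <-] := cell_box_surj cla cmu; apply/val_inj.
  by rewrite /= -(filling_ofE d fQ) -(filling_ofE d fQ') QQ'.
move: (cla) (cla) (rQ c) (rQ' c); rewrite -{1}Qb -Qb' !inE.
by move=> /negbTE -> /negbTE -> /= /eqP -> /eqP ->.
Qed.

Lemma filling_of_surj P : (forall d, val (P d) <= b) ->
  exists2 Q, fits Q & filling_of Q = P.
Proof.
move=> Pb.
pose q c : 'I_b.+2 := if [pick d | cell_box d == c] is Some d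
  then inord (val (P d)) else if c \in box mu then ord0 else ord_max.
have qE d : q (cell_box d) = val (P d) :> nat.
  rewrite /q; case: pickP => [e /eqP /cell_box_inj ->|/(_ d)].
    by rewrite inordK // !ltnS ltnW // ltnS.
  by rewrite eqxx.
have qmu c : c \in box mu -> q c = ord0.
  move=> cmu; rewrite /q; case: pickP => [e /eqP ec|_]; last by rewrite cmu.
  by have := cell_box_mu e; rewrite ec cmu.
have qla c : c \notin box la -> q c = ord_max.
  move=> cla; rewrite /q; case: pickP => [e /eqP ec|_].
    by have := cell_box_la e; rewrite ec (negbTE cla).
  case: ifP => // cmu; case/negP: cla; move: cmu; rewrite !mem_box.
  by move=> /leq_trans; apply.
have fq : fits [ffun c => q c].
  have rq c : (c \in box mu) || (c \notin box la) ||
              [exists d, cell_box d == c].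
    case: (boolP (c \in box mu)) => //= cmu.
    case: (boolP (c \in box la)) => //= cla.
    by have [d <-] := cell_box_surj cla cmu; apply/existsP; exists d.
  apply/and3P; split; [apply/eqP/setP => c|apply/eqP/setP => c|apply/forallP => c].
  - rewrite inE ffunE; case/orP: (rq c) => [/orP[cmu|cla]|/existsP[d /eqP <-]].
    + by rewrite qmu // cmu.
    + rewrite qla //; apply/esym/negbTE; apply: contraNN cla; rewrite !mem_box.
      by move=> /leq_trans; apply.
    + rewrite qE (negbTE (cell_box_mu d)).
      by apply/negbTE; rewrite -ltnNge; apply: (valP (P d)).
  - rewrite inE ffunE; case/orP: (rq c) => [/orP[cmu|cla]|/existsP[d /eqP <-]].
    + rewrite qmu //=; apply/esym; move: cmu; rewrite !mem_box.
      by move=> /leq_trans; apply.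
    + by rewrite qla //= (negbTE cla) ltnn.
    + by rewrite qE Pb cell_box_la.
  - rewrite ffunE; case/orP: (rq c) => [/orP[cmu|cla]|/existsP[d /eqP <-]].
    + by rewrite qmu.
    + by rewrite qla // eqxx orbT.
    + by rewrite qE Pb.
exists [ffun c => q c] => //; apply/ffunP => d; apply/val_inj.
by rewrite filling_ofE // ffunE qE.
Qed.

(** A filling is monotone exactly when its sublevel sets are ideals. *)
Lemma is_rpp_filling_of Q : fits Q ->
  is_rpp (filling_of Q) <-> (forall j, j <= b -> ideal (lev Q j)).
Proof.
move=> fQ; have /and3P[/eqP Q0 /eqP Qb _] := fQ; split=> [[rowQ colQ] j jb|H].
  apply/idealP => c d cj d1 d2.
  have cla : c \in box la by rewrite -Qb (subsetP (levS _ jb)).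
  have [dmu|dmu] := boolP (d \in box mu).
    by apply: (subsetP (levS Q (leq0n j))); rewrite Q0.
  (* The comparison of [d] with [c] goes along the row of [d], then down the column of [c]; the
     corner [(d.1, c.2)] lies in the skew shape because both boundary shapes are ideals. *)
  have ela : (d.1, c.2) \in box la by apply: (idealP _ la_ideal) cla _ _.
  have dla : d \in box la by apply: (idealP _ la_ideal) cla _ _.
  have emu : (d.1, c.2) \notin box mu.
    by apply: contraNN dmu => emu; apply: (idealP _ mu_ideal) emu _ _.
  have cmu : c \notin box mu.
    by apply: contraNN dmu => cmu; apply: (idealP _ mu_ideal) cmu _ _.
  have [c' Ec] := cell_box_surj cla cmu.
  have [d' Ed] := cell_box_surj dla dmu.
  have [e' Ee] := cell_box_surj ela emu.
  move: cj; rewrite !inE -Ec -Ed -!filling_ofE //; apply: leq_trans.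
  apply: (@leq_trans (val (filling_of Q e'))).
    by apply: rowQ; rewrite -?cell_box1 -?cell_box2 Ed Ee.
  by apply: colQ; rewrite -?cell_box1 -?cell_box2 Ec Ee.
have mono (c d : C) : c.1 <= d.1 -> c.2 <= d.2 -> Q d <= b -> Q c <= Q d.
  move=> c1 c2 db; have := idealP _ (H _ db) d c.
  by rewrite !inE leqnn; apply.
by split=> c d; rewrite -!cell_box1 -!cell_box2 !filling_ofE // => E le;
  apply: mono; rewrite ?E ?fits_le.
Qed.

Lemma weight_filling_of Q (i : posint) : fits Q ->
  weight (filling_of Q) i =
  if val i <= b then ncols (lev Q (val i) :\: lev Q (val i).-1) else 0.
Proof.
move=> fQ; rewrite weightE; case: leqP => ib; last first.
  apply/eqP; rewrite cardfs_eq0; apply/eqP/fsetP => j; rewrite in_fset0.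
  apply/negP => /imfsetP[d /= /eqP di _].
  by have := fits_le d fQ; rewrite -filling_ofE // di leqNgt ib.
have /and3P[/eqP Q0 /eqP Qb _] := fQ.
have -> : columns_with (filling_of Q) i =
  [fset (val j : nat) | j in [set c.2 | c in lev Q (val i) :\: lev Q (val i).-1]]%fset.
  have i0 := valP i.
  apply/fsetP => j; apply/imfsetP/imfsetP => /= -[].
    move=> d /eqP di ->; exists (cell_box d).2; last by rewrite cell_box2.
    apply/imsetP; exists (cell_box d) => //.
    by rewrite !inE -filling_ofE // di leqnn andbT -ltnNge prednK.
  move=> k /imsetP[c + ->] ->; rewrite !inE -ltnNge => /andP[ci ci'].
  have cla : c \in box la by rewrite -Qb inE (leq_trans ci').
  have cmu : c \notin box mu.
    by rewrite -Q0 inE -ltnNge (leq_ltn_trans _ ci).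
  have [d Ed] := cell_box_surj cla cmu; exists d; last by rewrite -Ed cell_box2.
  rewrite inE; apply/eqP/val_inj; rewrite filling_ofE // Ed /=.
  by apply/eqP; rewrite eqn_leq ci' /= -(prednK i0).
by rewrite card_imfset //=; [rewrite -cardE|exact: val_inj].
Qed.

(** Only fillings of weight [m] contribute to this coefficient, each by 1. They are in bijection
    with the finite set [G] of level functions counted by [card_good]. *)
Lemma dual_groth_chains :
  dual_groth la mu m = (chains (exponent m) b (box la) (box mu))%:R%R.
Proof.
set G := [set Q : levels | good (exponent m) (box mu) b Q & lev Q b == box la].
have GP Q : Q \in G ->
  [/\ fits Q, is_rpp (filling_of Q) & weight (filling_of Q) = m].
  rewrite inE => /andP[gQ Qb]; have /and3P[Q0 /allP st rg] := gQ.
  have fQ : fits Q by rewrite /fits Q0 Qb rg.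
  split=> //; first by apply/is_rpp_filling_of => // j; apply: good_lev_ideal gQ.
  apply/fsfunP => i; rewrite weight_filling_of //; case: leqP => ib.
    have i0 := valP i.
    have /st /andP[_ /eqP ->] : val i \in iota 1 b by rewrite mem_iota add1n ltnS ib andbT.
    by rewrite /exponent valK.
  by rewrite m_le.
have GS P : is_rpp P -> weight P = m -> exists2 Q, Q \in G & filling_of Q = P.
  move=> rP wP.
  (* An entry above [b] would put into the weight a variable that is absent from [m]. *)
  have [d|Q fQ QP] := @filling_of_surj P.
    rewrite leqNgt; apply/negP => /m_le; rewrite -wP weightE => /eqP.
    rewrite cardfs_eq0 => /eqP E.
    have : (val d).2 \in columns_with P (P d).
      by apply/imfsetP; exists d => //=; rewrite inE.
    by rewrite E in_fset0.
  exists Q => //; rewrite -QP in rP wP.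
  move/(is_rpp_filling_of fQ): rP => rP.
  have /and3P[Q0 Qb rg] := fQ.
  rewrite inE Qb andbT; apply/and3P; split=> //.
  apply/allP => j; rewrite mem_iota => jb; rewrite /good_level rP /=; last by lia.
  have j0 : 0 < j by lia.
  have := weight_filling_of (exist _ j j0 : posint) fQ; rewrite wP /=.
  have -> : j <= b by lia.
  by rewrite /exponent insubT => ->.
pose r := [seq filling_of Q | Q <- enum G].
have memr P : reflect (is_rpp P /\ weight P = m) (P \in r).
  apply: (iffP mapP) => [[Q + ->]|[rP wP]].
    by rewrite mem_enum => /GP[].
  by have [Q QG <-] := GS _ rP wP; exists Q; rewrite ?mem_enum.
have ur : uniq r.
  rewrite map_inj_in_uniq ?enum_uniq // => Q Q'; rewrite !mem_enum.
  by move=> /GP[fQ _ _] /GP[fQ' _ _]; apply: filling_of_inj.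
rewrite /dual_groth (fsbigE r) //; first last.
- move=> P rP /negP Pr; rewrite /monomial_series; case: eqP => // wP.
  by case: Pr; apply/memr.
- by move=> P /memr[].
rewrite big_seq_cond (eq_bigr (fun=> 1%R)); last first.
  by move=> P /andP[/memr[_ wP] _]; rewrite /monomial_series wP eqxx.
rewrite (eq_bigl (fun P => P \in r)) => [|P]; last first.
  by apply: andb_idr => /memr[rP _]; apply/mem_set.
rewrite -big_seq big_const_seq count_predT size_map -cardE iter_addr_0.
by rewrite (card_good _ _ _ (leqnn b)).
Qed.

End Fillings.

Theorem lemma1p1 (n k : nat) (hk : 0 < k <= n) :
  dual_groth (staircase n) [:: k]
  = dual_groth (staircase n) (conj_part [:: k]).
Proof.
have /andP[k0 kn] := hk; rewrite conj_part_row; apply/funext => m.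
case: n => [|n] in hk kn *; first by lia.
(* The largest variable occurring in [m] bounds the number of steps needed for this coefficient. *)
pose b := \max_(i <- finsupp m) val i.
have m_le (i : posint) : b < val i -> m i = 0.
  move=> bi; apply/eqP; apply: contraTT bi; rewrite -mem_finsupp -leqNgt => im.
  exact: leq_bigmax_seq.
have stE i : nth 0 (staircase n.+1) i = n.+1 - i.
  case: (ltnP i n.+1) => ilt; last first.
    by rewrite nth_default ?size_rev ?size_iota //; lia.
  by rewrite nth_rev size_iota // nth_iota; lia.
have shE : shape n.+1 (staircase n.+1) = stair n.+1.
  by apply/setP => c; rewrite !inE stE.
have sz : size (staircase n.+1) <= n.+1 by rewrite size_rev size_iota.
have colI : ideal (shape n.+1 (nseq k 1)).
  by rewrite shape_col ideal_transp ideal_shape_row.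
have st_le i : nth 0 (staircase n.+1) i <= n.+1 by rewrite stE leq_subr.
have row_le i : nth 0 [:: k] i <= nth 0 (staircase n.+1) i.
  by rewrite stE; case: i => [|i] /=; rewrite ?nth_nil // subn0.
have col_le i : nth 0 (nseq k 1) i <= nth 0 (staircase n.+1) i.
  by rewrite stE nth_nseq; case: ltnP; lia.
rewrite !(@dual_groth_chains n b) ?shE ?ideal_stair ?ideal_shape_row //.
by rewrite chains_row_col.
Qed.
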